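(* Let $K$ be a commutative ring with $\frac12\in K$, let $n\ge1$, let $\delta$ be a $K$-derivation of $\Lambda_n(K)$, and for each $i=1,\ldots,n$ write $\delta(x_i)=u_i^{ev}+u_i^{od}$ with unique elements $u_i^{ev}\in\Lambda_n^{ev}$ and $u_i^{od}\in\Lambda_n^{od}$. Let $\delta=\delta^{ev}+\delta^{od}$ be the unique decomposition of $\delta$ into a sum of an even and an odd $K$-derivation. Then: 1. $\delta^{ev}=\sum_{i=1}^n u_i^{od}\partial_i$, and 2. $\delta^{od}=-\frac12\mathrm{ad}(a)$ where the unique element $a\in\Lambda_n'^{od}$ is given by the formula $$a=\sum_{i=1}^{n-1}x_1\cdots x_i\,\partial_i\cdots\partial_1\partial_{i+1}(u_{i+1}^{ev})+\partial_1(u_1^{ev}).$$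
   Context: $\Lambda_n=\Lambda_n(K)=K\lfloor x_1,\ldots,x_n\rfloor$ is the Grassmann algebra: the $K$-algebra with generators $x_1,\ldots,x_n$ and defining relations $x_i^2=0$, $x_ix_j=-x_jx_i$ ($i\ne j$); it is a free $K$-module with basis $x^\alpha=x_1^{\alpha_1}\cdots x_n^{\alpha_n}$, $\alpha\in\{0,1\}^n$. Put $|\alpha|=\alpha_1+\cdots+\alpha_n$, $\Lambda_{n,i}=\bigoplus_{|\alpha|=i}Kx^\alpha$, $\Lambda_n^{ev}=\bigoplus_{i\text{ even}}\Lambda_{n,i}$, $\Lambda_n^{od}=\bigoplus_{i\text{ odd}}\Lambda_{n,i}$. The $K$-linear partial skew derivatives $\partial_1,\ldots,\partial_n$ of $\Lambda_n$ are determined by $\partial_i(x_j)=\delta_{ij}$ and $\partial_i(ab)=\partial_i(a)b+(-1)^s a\,\partial_i(b)$ for $a\in\Lambda_{n,s}$, $b\in\Lambda_n$. A $K$-derivation of $\Lambda_n$ is even if it maps $\Lambda_n^{ev}$ to $\Lambda_n^{ev}$ and $\Lambda_n^{od}$ to $\Lambda_n^{od}$, and odd if it maps $\Lambda_n^{ev}$ to $\Lambda_n^{od}$ and $\Lambda_n^{od}$ to $\Lambda_n^{ev}$; every $K$-derivation is a unique sum of an even and an odd one. $\mathrm{ad}(a)(b)=ab-ba$. $\Lambda_n'^{od}=\Lambda_n^{od}$ if $n$ is even; if $n$ is odd, $\Lambda_n'^{od}$ is the $K$-submodule of $\Lambda_n^{od}$ spanned by all odd-degree monomials $x^\alpha$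 other than $x_1\cdots x_n$. *)

(* Defs.v *)
From HB Require Import structures.
From mathcomp Require Import all_boot all_order all_algebra ring.

Set Implicit Arguments.
Unset Strict Implicit.
Unset Printing Implicit Defensive.

Import GRing.Theory.
Local Open Scope ring_scope.

(* An element is the family of its coefficients: S stands for the monomial x^S,
   the product of the x_i, i in S, in increasing order. The product of
   grassmann K n is gmul below, not the pointwise product of finite functions. *)
Definition grassmann (K : comPzRingType) (n : nat) := {ffun {set 'I_n} -> K}.

HB.instance Definition _ (K : comPzRingType) (n : nat) :=
  GRing.Zmodule.on (grassmann K n).

Section Grassmann.
Variables (K : comPzRingType) (n : nat).
Local Notation L := (grassmann K n).
Implicit Types (f g : L) (A B C S : {set 'I_n}) (i j : 'I_n).

Definition gscale (c : K) f : L := [ffun S : {set 'I_n} => c * f S].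

Lemma gscaleA c d f : gscale c (gscale d f) = gscale (c * d) f.
Proof. by apply/ffunP=> S; rewrite !ffunE mulrA. Qed.
Lemma gscale1 : left_id 1 gscale.
Proof. by move=> f; apply/ffunP=> S; rewrite !ffunE mul1r. Qed.
Lemma gscaleDr : right_distributive gscale +%R.
Proof. by move=> c f g; apply/ffunP=> S; rewrite !ffunE mulrDr. Qed.
Lemma gscaleDl f : {morph gscale^~ f : c d / c + d}.
Proof. by move=> c d; apply/ffunP=> S; rewrite !ffunE mulrDl. Qed.

HB.instance Definition _ :=
  GRing.Zmodule_isLmodule.Build K L gscaleA gscale1 gscaleDr gscaleDl.

Definition inversions A B : nat :=
  (\sum_(i in A) \sum_(j in B) (j < i)%N)%N.

(* x^A x^B = (-1)^(inversions A B) x^(A u B) for disjoint A and B, and 0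
   otherwise. *)
Definition gmul f g : L :=
  [ffun S : {set 'I_n} => \sum_(A : {set 'I_n} | A \subset S)
     (-1) ^+ inversions A (S :\: A) * f A * g (S :\: A)].

Definition gmonomial A : L := [ffun B : {set 'I_n} => (B == A)%:R].

Lemma inversions0l A : inversions set0 A = 0%N.
Proof. by rewrite /inversions big_set0. Qed.

Lemma inversions0r A : inversions A set0 = 0%N.
Proof. by rewrite /inversions big1 // => i _; rewrite big_set0. Qed.

Lemma inversionsUl A B C : [disjoint A & B] ->
  inversions (A :|: B) C = (inversions A C + inversions B C)%N.
Proof.
move=> dAB; rewrite /inversions -bigU //=.
by apply: eq_bigl => i; rewrite !inE.
Qed.

Lemma inversionsUr A B C : [disjoint A & B] ->
  inversions C (A :|: B) = (inversions C A + inversions C B)%N.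
Proof.
move=> dAB; rewrite /inversions -big_split /=.
apply: eq_bigr => i _; rewrite -bigU //=.
by apply: eq_bigl => j; rewrite !inE.
Qed.

Lemma setUD_sub A S : A \subset S -> A :|: S :\: A = S.
Proof. by move=> sAS; rewrite -{2}(setID S A) (setIidPr sAS). Qed.

Lemma disjointD A S : [disjoint A & S :\: A].
Proof. by rewrite disjoints_subset setCD subsetUr. Qed.

Lemma gmulA : associative gmul.
Proof.
move=> f g h; apply/ffunP => S; rewrite !ffunE.
pose F A B := (-1) ^+ (inversions A B + inversions A (S :\: (A :|: B))
  + inversions B (S :\: (A :|: B)))%N * f A * g B * h (S :\: (A :|: B)).
transitivity (\sum_(A : {set 'I_n} | A \subset S)
    \sum_(B : {set 'I_n} | B \subset S :\: A) F A B).
  apply: eq_bigr => A sAS; rewrite ffunE mulr_sumr.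
  apply: eq_bigr => B sB; rewrite /F.
  have -> : inversions A (S :\: A) =
      (inversions A B + inversions A (S :\: (A :|: B)))%N.
    by rewrite -setDDl -inversionsUr ?disjointD // setUD_sub.
  by rewrite setDDl !exprD; ring.
transitivity (\sum_(C : {set 'I_n} | C \subset S)
    \sum_(A : {set 'I_n} | A \subset C) F A (C :\: A)); last first.
  apply: eq_bigr => C sCS; rewrite ffunE mulr_sumr mulr_suml.
  apply: eq_bigr => A sAC; rewrite /F setUD_sub //.
  have -> : inversions C (S :\: C) =
      (inversions A (S :\: C) + inversions (C :\: A) (S :\: C))%N.
    by rewrite -inversionsUl ?disjointD // setUD_sub.
  by rewrite !exprD; ring.
rewrite [RHS](exchange_big_dep (fun A : {set 'I_n} => A \subset S)) /=; last first.
  by move=> C A sCS sAC; apply: subset_trans sCS.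
apply: eq_bigr => A sAS.
have dAB B : [disjoint A & B] -> (A :|: B) :\: A = B.
  by rewrite disjoint_sym setDUl setDv set0U => /setDidPl.
rewrite [RHS](reindex_onto (fun B => A :|: B) (fun C => C :\: A)) /=; last first.
  by move=> C /andP[_ sAC]; rewrite setUD_sub.
apply: eq_big => [B|B].
  rewrite subUset sAS subsetUl andbT subsetD disjoint_sym.
  congr (_ && _); apply/idP/eqP => [/dAB //|<-]; exact: disjointD.
by rewrite subsetD disjoint_sym => /andP[_ /dAB ->].
Qed.

Lemma gmul1l : left_id (gmonomial set0) gmul.
Proof.
move=> f; apply/ffunP => S; rewrite ffunE (bigD1 set0) ?sub0set //=.
rewrite inversions0l setD0 ffunE eqxx expr0 !mul1r big1 ?addr0 // => A /andP[_ nA].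
by rewrite ffunE (negPf nA) mulr0 mul0r.
Qed.

Lemma gmul1r : right_id (gmonomial set0) gmul.
Proof.
move=> f; apply/ffunP => S; rewrite ffunE (bigD1 S) //= setDv.
rewrite inversions0r ffunE eqxx expr0 mul1r mulr1 big1 ?addr0 // => A /andP[sAS nA].
rewrite ffunE setD_eq0; case: (boolP (S \subset A)) => [sSA|_]; last by rewrite mulr0.
by rewrite eqEsubset sAS sSA in nA.
Qed.

Lemma gmulDl : left_distributive gmul +%R.
Proof.
move=> f g h; apply/ffunP => S; rewrite !ffunE -big_split.
by apply: eq_bigr => A _; rewrite ffunE mulrDr mulrDl.
Qed.

Lemma gmulDr : right_distributive gmul +%R.
Proof.
move=> f g h; apply/ffunP => S; rewrite !ffunE -big_split.
by apply: eq_bigr => A _; rewrite ffunE mulrDr.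
Qed.

HB.instance Definition _ :=
  GRing.Zmodule_isPzRing.Build L gmulA gmul1l gmul1r gmulDl gmulDr.

Lemma gmulE f g S : (f * g) S = \sum_(A : {set 'I_n} | A \subset S)
  (-1) ^+ inversions A (S :\: A) * f A * g (S :\: A).
Proof. by rewrite ffunE. Qed.

Lemma goneE S : (1 : L) S = (S == set0)%:R.
Proof. by rewrite ffunE. Qed.

Lemma gscaleE (c : K) f S : (c *: f) S = c * f S.
Proof. by rewrite ffunE. Qed.

Lemma gscaleAl (c : K) f g : c *: (f * g) = c *: f * g.
Proof.
apply/ffunP => S; rewrite gscaleE !gmulE mulr_sumr.
by apply: eq_bigr => A _; rewrite gscaleE; ring.
Qed.

Lemma gscaleAr (c : K) f g : c *: (f * g) = f * (c *: g).
Proof.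
apply/ffunP => S; rewrite gscaleE !gmulE mulr_sumr.
by apply: eq_bigr => A _; rewrite gscaleE; ring.
Qed.

Lemma gmonomialM A B : gmonomial A * gmonomial B =
  if [disjoint A & B] then (-1) ^+ inversions A B *: gmonomial (A :|: B) else 0.
Proof.
apply/ffunP => S; rewrite gmulE.
have [sAS|nAS] := boolP (A \subset S); last first.
  rewrite big1 => [|C sCS]; last first.
    rewrite [gmonomial A C]ffunE; case: eqP => [eCA|_]; last by rewrite mulr0 mul0r.
    by rewrite -eCA sCS in nAS.
  case: ifP => _; rewrite !ffunE //.
  by case: eqP => [eS|]; rewrite ?mulr0 // eS subsetUl in nAS *.
rewrite (bigD1 A) //= big1 ?addr0 => [|C /andP[_ nCA]]; last first.
  by rewrite [gmonomial A C]ffunE (negPf nCA) mulr0 mul0r.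
rewrite [gmonomial A A]ffunE eqxx mulr1 [gmonomial B _]ffunE.
case: eqP => [<-|neB]; first by rewrite disjointD gscaleE ffunE setUD_sub ?eqxx.
case: ifP => dAB; rewrite mulr0 ?gscaleE ffunE //.
case: eqP => [eS|]; rewrite ?mulr0 //; case: neB; rewrite eS setDUl setDv set0U.
by apply/setDidPl; rewrite disjoint_sym.
Qed.

Definition gen i : L := gmonomial [set i].

Lemma gen_sq i : gen i * gen i = 0.
Proof.
rewrite gmonomialM; case: ifP => // /disjoint_setI0/setP/(_ i).
by rewrite !inE eqxx.
Qed.

Lemma gen_anticomm i j : i != j -> gen i * gen j = - (gen j * gen i).
Proof.
move=> nij; rewrite !gmonomialM !disjoints1 !inE (eq_sym j) nij /=.
rewrite setUC /inversions !big_set1 -scaleNr.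
by case: (ltngtP i j) nij => [||/val_inj ->]; rewrite ?eqxx ?expr0 ?expr1 ?opprK.
Qed.

Let lt_ord := relpre (@nat_of_ord n) ltn.

Let lt_ord_trans : transitive lt_ord.
Proof. by move=> i j k; apply: ltn_trans. Qed.

Lemma gmonomial_prod A : gmonomial A = \prod_(i <- enum A) gen i.
Proof.
have: sorted lt_ord (enum A).
  rewrite /enum_mem -enumT; apply: sorted_filter; first exact: lt_ord_trans.
  by rewrite -sorted_map val_enum_ord iota_ltn_sorted.
have -> : gmonomial A = gmonomial [set i in enum A].
  by congr gmonomial; apply/setP => i; rewrite inE mem_enum.
elim: (enum A) => [|i s IHs] /=.
  by move=> _; rewrite big_nil; congr gmonomial; apply/setP=> i; rewrite !inE.
rewrite path_sortedE => [/andP[/allP lt_is /IHs {IHs} IHs]|]; last first.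
  exact: lt_ord_trans.
rewrite big_cons -IHs gmonomialM.
have -> : [disjoint [set i] & [set j in s]].
  by rewrite disjoints1 inE; apply/negP => /lt_is /=; rewrite ltnn.
have -> : inversions [set i] [set j in s] = 0%N.
  rewrite /inversions big_set1 big1 // => j; rewrite inE => /lt_is lt_ij.
  by rewrite ltnNge ltnW.
by rewrite scale1r; congr gmonomial; apply/setP => j; rewrite !inE.
Qed.

Lemma gmonomial_span f : f = \sum_A f A *: gmonomial A.
Proof.
apply/ffunP => S; rewrite sum_ffunE (bigD1 S) //= gscaleE ffunE eqxx mulr1.
rewrite big1 ?addr0 // => A nAS.
by rewrite gscaleE ffunE eq_sym (negPf nAS) mulr0.
Qed.

Lemma gmonomial_free (c : {set 'I_n} -> K) :
  \sum_A c A *: gmonomial A = 0 -> forall A, c A = 0.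
Proof.
move/ffunP => c0 A; have := c0 A.
rewrite sum_ffunE (bigD1 A) //= gscaleE !ffunE eqxx mulr1.
rewrite big1 ?addr0 // => B nBA.
by rewrite gscaleE ffunE eq_sym (negPf nBA) mulr0.
Qed.

Definition homogeneous (s : nat) : {pred L} :=
  [pred f : L | [forall S, (f S != 0) ==> (#|S| == s)]].

Definition geven : {pred L} :=
  [pred f : L | [forall S, (f S != 0) ==> ~~ odd #|S|]].

Definition godd : {pred L} :=
  [pred f : L | [forall S, (f S != 0) ==> odd #|S|]].

Definition godd' : {pred L} :=
  [pred f : L | (f \in godd) && (odd n ==> (f [set: 'I_n] == 0))].

(* Since x^(i |: S) = (-1)^(inversions [set i] S) x_i x^S for i \notin S, this
   is the operator with f = f0 + x_i * partial i f, where x_i occurs neither in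
   f0 nor in partial i f. *)
Definition partial i f : L := [ffun S : {set 'I_n} =>
  if i \in S then 0 else (-1) ^+ inversions [set i] S * f (i |: S)].

Lemma partial_is_linear i : linear (partial i).
Proof.
move=> c f g; apply/ffunP => S; rewrite !ffunE.
by case: ifP => _; [rewrite mulr0 addr0 | ring].
Qed.
HB.instance Definition _ i :=
  GRing.isLinear.Build K L L _ (partial i) (partial_is_linear i).

Lemma partial_gen i j : partial i (gen j) = (i == j)%:R.
Proof.
apply/ffunP => S; rewrite !ffunE.
have eS : i \notin S -> (i |: S == [set j]) = (i == j) && (S == set0).
  move=> niS; apply/eqP/andP => [eS|[/eqP<- /eqP->]]; last by rewrite setU0.
  have : i \in [set j] by rewrite -eS setU11.
  rewrite inE => /eqP eij; rewrite eij eqxx; split=> //; apply/set0Pn => -[k kS].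
  have : k \in [set j] by rewrite -eS setU1r.
  by rewrite inE -eij => /eqP eki; rewrite -eki kS in niS.
case: ifPn => [iS|/[dup] niS /eS ->].
  case: eqVneq => _; rewrite /= ffunE //; case: eqP iS => // ->.
  by rewrite inE.
case: eqVneq => _; rewrite /= ffunE ?mulr0 //.
by case: eqP => [->|]; rewrite ?mulr0 // inversions0r mulr1.
Qed.

Lemma homogeneousP s f :
  reflect (forall S, #|S| != s -> f S = 0) (f \in homogeneous s).
Proof.
rewrite inE; apply: (iffP forallP) => H S; last first.
  by apply/implyP; apply: contraR => /H ->.
by have:= H S; case: eqP => //= _ /eqP ->; rewrite ?eqxx.
Qed.

Lemma gevenP f : reflect (forall S, odd #|S| -> f S = 0) (f \in geven).
Proof.
rewrite inE; apply: (iffP forallP) => H S; last first.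
  by apply/implyP; apply: contra => /H ->.
by have:= H S; case: eqP => //= _; case: odd.
Qed.

Lemma goddP f : reflect (forall S, ~~ odd #|S| -> f S = 0) (f \in godd).
Proof.
rewrite inE; apply: (iffP forallP) => H S; last first.
  by apply/implyP; apply: contraR => /H ->.
by have:= H S; case: eqP => //= _; case: odd.
Qed.

Definition indep i f := forall S, i \in S -> f S = 0.
Definition gsign f : L := [ffun S : {set 'I_n} => (-1) ^+ #|S| * f S].
Definition gdrop i f : L := [ffun S : {set 'I_n} => if i \in S then 0 else f S].

Lemma gdrop_indep i f : indep i (gdrop i f).
Proof. by move=> S iS; rewrite ffunE iS. Qed.

Lemma partial_indep i f : indep i (partial i f).
Proof. by move=> S iS; rewrite ffunE iS. Qed.

Lemma gsign_indep i f : indep i f -> indep i (gsign f).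
Proof. by move=> fi S iS; rewrite ffunE fi // mulr0. Qed.

Lemma gmul_indep i f g : indep i f -> indep i g -> indep i (f * g).
Proof.
move=> fi gi S iS; rewrite gmulE big1 // => A sAS.
have [iA|niA] := boolP (i \in A); first by rewrite fi // mulr0 mul0r.
by rewrite gi ?mulr0 // inE niA.
Qed.

Lemma gen_mulE i f S : (gen i * f) S =
  if i \in S then (-1) ^+ inversions [set i] (S :\ i) * f (S :\ i) else 0.
Proof.
rewrite gmulE; case: ifPn => iS.
  rewrite (bigD1 [set i]) ?sub1set //= ffunE eqxx mulr1 big1 ?addr0 //.
  by move=> A /andP[_ nA]; rewrite ffunE (negPf nA) mulr0 mul0r.
rewrite big1 // => A sAS; rewrite ffunE; case: eqP => [eA|]; last by rewrite mulr0 mul0r.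
by rewrite eA sub1set (negPf iS) in sAS.
Qed.

Lemma mul_genE i f S : (f * gen i) S =
  if i \in S then (-1) ^+ inversions (S :\ i) [set i] * f (S :\ i) else 0.
Proof.
rewrite gmulE; case: ifPn => iS.
  have siS : [set i] \subset S by rewrite sub1set.
  have DD : S :\: (S :\ i) = [set i] by rewrite setDDr setDv set0U; apply/setIidPr.
  rewrite (bigD1 (S :\ i)) ?subsetDl //= DD ffunE eqxx mulr1 big1 ?addr0 //.
  move=> A /andP[sAS nA]; rewrite ffunE; case: eqP => [eA|]; last by rewrite mulr0.
  by rewrite -eA setDDr setDv set0U (setIidPr sAS) eqxx in nA.
rewrite big1 // => A sAS; rewrite ffunE; case: eqP => [eA|]; last by rewrite mulr0.
by move/setP/(_ i): eA; rewrite !inE (negPf iS) andbF eqxx.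
Qed.

Lemma inversions1C i S : i \notin S ->
  (inversions [set i] S + inversions S [set i])%N = #|S|.
Proof.
move=> niS; rewrite /inversions big_set1 -big_split /= -sum1_card.
apply: eq_bigr => j jS; rewrite big_set1.
by case: ltngtP => // /val_inj eij; rewrite -eij jS in niS.
Qed.

Lemma signMK (m : nat) (c : K) : (-1) ^+ m * ((-1) ^+ m * c) = c.
Proof. by rewrite mulrA -expr2 sqrr_sign mul1r. Qed.

Lemma mul_gen i f : f * gen i = gen i * gsign f.
Proof.
apply/ffunP => S; rewrite mul_genE gen_mulE; case: ifP => // iS.
rewrite ffunE -(@inversions1C i (S :\ i)) ?setD11 // exprD.
by rewrite -[_ * _ * f _]mulrA signMK.
Qed.

Lemma gdrop_partial i f : f = gdrop i f + gen i * partial i f.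
Proof.
apply/ffunP => S; rewrite ffunE gen_mulE !ffunE setD11.
case: ifP => iS; last by rewrite addr0.
by rewrite add0r setD1K // signMK.
Qed.

Lemma partial_indep0 i f : indep i f -> partial i f = 0.
Proof.
move=> fi; apply/ffunP => S; rewrite !ffunE fi ?setU11 // mulr0.
by rewrite if_same.
Qed.

Lemma partial_gen_mul i f : indep i f -> partial i (gen i * f) = f.
Proof.
move=> fi; apply/ffunP => S; rewrite ffunE; case: ifP => iS; first by rewrite fi.
by rewrite gen_mulE setU11 setU1K ?iS // signMK.
Qed.

Lemma gsignM f g : gsign (f * g) = gsign f * gsign g.
Proof.
apply/ffunP => S; rewrite ffunE !gmulE mulr_sumr; apply: eq_bigr => A sAS.
rewrite !ffunE -(cardsID A S) (setIidPr sAS) exprD; ring.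
Qed.

Lemma gsignD f g : gsign (f + g) = gsign f + gsign g.
Proof. by apply/ffunP => S; rewrite !ffunE mulrDr. Qed.

Lemma gsign_gen i : gsign (gen i) = - gen i.
Proof.
apply/ffunP => S; rewrite !ffunE; case: eqP => [->|]; last by rewrite mulr0 oppr0.
by rewrite cards1 expr1 mulr1.
Qed.

Lemma partial_mul i f g :
  partial i (f * g) = partial i f * g + gsign f * partial i g.
Proof.
have fi := @partial_indep i f; have gi := @partial_indep i g.
have f0i := @gdrop_indep i f; have g0i := @gdrop_indep i g.
have ff := gdrop_partial i f; have gg := gdrop_partial i g.
move: (partial i f) (partial i g) (gdrop i f) (gdrop i g) fi gi f0i g0i ff gg.
move=> f1 g1 f0 g0 f1i g1i f0i g0i -> ->.
have -> : (f0 + gen i * f1) * (g0 + gen i * g1) =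
   f0 * g0 + gen i * (gsign f0 * g1 + f1 * g0).
  rewrite mulrDl !mulrDr !mulrA mul_gen -(mulrA (gen i) f1 (gen i)) mul_gen.
  by rewrite mulrA gen_sq !mul0r addr0 -addrA; congr (_ + _).
rewrite linearD /= partial_indep0 ?add0r; last exact: gmul_indep.
rewrite partial_gen_mul; last first.
  move=> S iS; rewrite ffunE !(@gmul_indep i) ?addr0 //; exact: gsign_indep.
rewrite gsignD gsignM gsign_gen mulrDr mulrDl mulrA mul_gen mulNr.
by rewrite addrCA addrA mulNr addrA addrK.
Qed.

Lemma gsign_homogeneous s f : f \in homogeneous s -> gsign f = (-1) ^+ s *: f.
Proof.
move=> /homogeneousP fs; apply/ffunP => S; rewrite ffunE gscaleE.
by have [->//|/fs ->] := eqVneq #|S| s; rewrite !mulr0.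
Qed.

Lemma partial_skew i s f g : f \in homogeneous s ->
  partial i (f * g) = partial i f * g + (-1) ^+ s *: (f * partial i g).
Proof. by move=> fs; rewrite partial_mul (gsign_homogeneous fs) gscaleAl. Qed.

Lemma gmonomial_homogeneous A : gmonomial A \in homogeneous #|A|.
Proof.
by apply/homogeneousP => S nS; rewrite ffunE; case: (S =P A) nS => // ->; case/eqP.
Qed.

Lemma partial_uniq i (d : {linear L -> L}) :
    (forall j, d (gen j) = (i == j)%:R) ->
    (forall s f g, f \in homogeneous s ->
       d (f * g) = d f * g + (-1) ^+ s *: (f * d g)) ->
  d =1 partial i.
Proof.
move=> d_gen d_skew f; rewrite (gmonomial_span f) !linear_sum /=.
apply: eq_bigr => A _; rewrite !linearZ /=; congr (_ *: _).
have h1 : (1 : L) \in homogeneous 0 by have := gmonomial_homogeneous set0; rewrite cards0.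
have hg j : gen j \in homogeneous 1 by have := gmonomial_homogeneous [set j]; rewrite cards1.
have d1 (e : {linear L -> L}) : (forall s f g, f \in homogeneous s ->
    e (f * g) = e f * g + (-1) ^+ s *: (f * e g)) -> e 1 = 0.
  move=> /(_ 0%N 1 1 h1); rewrite expr0 scale1r !mulr1 mul1r => e1.
  by apply: (addrI (e 1)); rewrite addr0 -e1.
have p_skew := @partial_skew i.
rewrite gmonomial_prod; elim: (enum A) => [|j s IHs]; first by rewrite big_nil !d1.
by rewrite big_cons (d_skew 1%N) // (p_skew 1%N) // IHs d_gen partial_gen.
Qed.

Definition ad f g : L := f * g - g * f.

Definition is_derivation (d : L -> L) := forall f g, d (f * g) = d f * g + f * d g.

Definition even_map (d : L -> L) :=
  {in geven, forall f, d f \in geven} /\ {in godd, forall f, d f \in godd}.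

Definition odd_map (d : L -> L) :=
  {in geven, forall f, d f \in godd} /\ {in godd, forall f, d f \in geven}.

(* For s = [:: j_1; ...; j_r], the operator partial j_r o ... o partial j_1. *)
Definition partials (s : seq 'I_n) f : L := foldl (fun g j => partial j g) f s.

Definition below i : seq 'I_n := [seq j : 'I_n <- enum 'I_n | (j < i)%N].

Definition parity_part (b : bool) f : L :=
  [ffun S : {set 'I_n} => if odd #|S| == b then f S else 0].

Lemma parity_part_is_linear b : linear (parity_part b).
Proof.
move=> c f g; apply/ffunP => S; rewrite !ffunE.
by case: ifP => _; [|rewrite mulr0 addr0].
Qed.
HB.instance Definition _ b :=
  GRing.isLinear.Build K L L _ (parity_part b) (parity_part_is_linear b).

Lemma parity_part_sum f : parity_part false f + parity_part true f = f.
Proof. by apply/ffunP => S; rewrite !ffunE; case: odd; rewrite /= ?add0r ?addr0. Qed.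

Lemma parity_part_geven f : parity_part false f \in geven.
Proof. by apply/gevenP => S oS; rewrite ffunE oS. Qed.

Lemma parity_part_godd f : parity_part true f \in godd.
Proof. by apply/goddP => S oS; rewrite ffunE (negPf oS). Qed.

Lemma geven_part f : f \in geven -> parity_part false f = f /\ parity_part true f = 0.
Proof.
move=> /gevenP fe; split; apply/ffunP => S; rewrite !ffunE;
  by case: (boolP (odd _)) => //= /fe ->.
Qed.

Lemma godd_part f : f \in godd -> parity_part false f = 0 /\ parity_part true f = f.
Proof.
move=> /goddP fo; split; apply/ffunP => S; rewrite !ffunE;
  by case: (boolP (odd _)) => //= /fo ->.
Qed.

Lemma parity_split_uniq fe fo ge go :
    fe \in geven -> fo \in godd -> ge \in geven -> go \in godd ->
  fe + fo = ge + go -> fe = ge /\ fo = go.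
Proof.
move=> /geven_part[e1 e2] /godd_part[e3 e4] /geven_part[e5 e6] /godd_part[e7 e8] E.
split; [move/(congr1 (parity_part false)): E|move/(congr1 (parity_part true)): E].
  by rewrite !linearD /= e1 e3 e5 e7 !addr0.
by rewrite !linearD /= e2 e4 e6 e8 !add0r.
Qed.

Lemma parity_partK b c f :
  parity_part b (parity_part c f) = if b == c then parity_part b f else 0.
Proof.
by apply/ffunP => S; case: b; case: c; rewrite /= !ffunE; case: (odd _).
Qed.

Lemma parity_partM b c f g : parity_part b (f * parity_part c g) =
  parity_part (b (+) c) f * parity_part c g.
Proof.
apply/ffunP => S; rewrite ffunE !gmulE.
have oddS A : A \subset S -> odd #|S| = odd #|A| (+) odd #|S :\: A|.
  by move=> sAS; rewrite -(cardsID A S) (setIidPr sAS) oddD.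
case: ifP => bS.
  apply: eq_bigr => A sAS; rewrite !ffunE; move: bS; rewrite (oddS A) //.
  by case: (odd #|A|); case: (odd _); case: b; case: c => //=; rewrite ?mulr0.
rewrite big1 // => A sAS; rewrite !ffunE; move: bS; rewrite (oddS A) //.
by case: (odd #|A|); case: (odd _); case: b; case: c => //=; rewrite ?mulr0 ?mul0r.
Qed.

Lemma parity_partMl b c f g : parity_part b (parity_part c f * g) =
  parity_part c f * parity_part (b (+) c) g.
Proof.
rewrite -{1}(parity_part_sum g) mulrDr linearD /= !parity_partM.
by rewrite !parity_partK; case: b; case: c => /=; rewrite ?mul0r ?add0r ?addr0.
Qed.

Definition derivation_part (t : bool) (d : L -> L) f : L :=
  parity_part t (d (parity_part false f)) + parity_part (~~ t) (d (parity_part true f)).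

Lemma derivation_part_is_linear t (d : {linear L -> L}) :
  linear (derivation_part t d).
Proof.
move=> c f g; rewrite /derivation_part !linearP /= scalerDr.
by rewrite addrACA.
Qed.
HB.instance Definition _ t (d : {linear L -> L}) :=
  GRing.isLinear.Build K L L _ (derivation_part t d) (derivation_part_is_linear t d).

Lemma derivation_part_parity t (d : {linear L -> L}) b f :
  derivation_part t d (parity_part b f) = parity_part (t (+) b) (d (parity_part b f)).
Proof.
by rewrite /derivation_part !parity_partK; case: b => /=;
  rewrite !linear0 ?add0r ?addr0 ?addbT ?addbF.
Qed.

Lemma derivation_part_derivation t (d : {linear L -> L}) :
  is_derivation d -> is_derivation (derivation_part t d).
Proof.
move=> dM.
have H b c f g : derivation_part t d (parity_part b f * parity_part c g) =
    derivation_part t d (parity_part b f) * parity_part c g +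
    parity_part b f * derivation_part t d (parity_part c g).
  have -> : parity_part b f * parity_part c g =
      parity_part (b (+) c) (parity_part b f * parity_part c g).
    by rewrite parity_partM parity_partK -addbA addbb addbF eqxx.
  rewrite !derivation_part_parity parity_partM parity_partK -addbA addbb addbF eqxx.
  rewrite dM linearD /= parity_partM parity_partMl.
  by congr (parity_part _ _ * _ + _ * parity_part _ _); case: t; case: b; case: c.
have D e h : derivation_part t d (e + h) = derivation_part t d e + derivation_part t d h.
  exact: linearD.
move: (derivation_part t d) H D => e H D f g.
rewrite -(parity_part_sum f) -(parity_part_sum g).
rewrite !mulrDl !mulrDr !D !H !mulrDl !mulrDr.
by rewrite [X in X + _ = _]addrACA [X in _ + X = _]addrACA [LHS]addrACA;
  congr (_ + _); rewrite addrACA.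
Qed.

Lemma derivation_parity_split (d : {linear L -> L}) : is_derivation d ->
  exists dev dod : {linear L -> L},
    [/\ is_derivation dev /\ even_map dev, is_derivation dod /\ odd_map dod
      & forall f, d f = dev f + dod f].
Proof.
move=> dM; exists (derivation_part false d), (derivation_part true d).
have D t := @derivation_part_derivation t d dM.
split.
- split; first exact: D.
  split=> f; rewrite /= /derivation_part.
    by move=> /geven_part[-> ->]; rewrite !linear0 addr0 parity_part_geven.
  by move=> /godd_part[-> ->]; rewrite !linear0 add0r parity_part_godd.
- split; first exact: D.
  split=> f; rewrite /= /derivation_part.
    by move=> /geven_part[-> ->]; rewrite !linear0 addr0 parity_part_godd.
  by move=> /godd_part[-> ->]; rewrite !linear0 add0r parity_part_geven.
move=> f; rewrite /= /derivation_part addrACA /= parity_part_sum.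
by rewrite [X in _ + X]addrC parity_part_sum -linearD /= parity_part_sum.
Qed.

Lemma derivation_parity_split_uniq (de do e o : {linear L -> L}) :
    even_map de -> odd_map do -> even_map e -> odd_map o ->
  (forall f, de f + do f = e f + o f) -> de =1 e /\ do =1 o.
Proof.
move=> [de0 de1] [do0 do1] [e0 e1] [o0 o1] E.
have Ef f : f \in geven -> de f = e f /\ do f = o f.
  by move=> fe; apply: parity_split_uniq (E f); auto.
have Of f : f \in godd -> de f = e f /\ do f = o f.
  move=> fo; have := E f; rewrite addrC [RHS]addrC => /parity_split_uniq.
  by case=> //; auto.
split=> f; rewrite -(parity_part_sum f) !linearD /=; congr (_ + _).
all: by case: (Ef _ (parity_part_geven f)); case: (Of _ (parity_part_godd f)).
Qed.

End Grassmann.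

Arguments geven {K n}.
Arguments godd {K n}.
Arguments godd' {K n}.
Arguments homogeneous {K n} s.

(* Main.v *)
From HB Require Import structures.
Require Import Defs.
From mathcomp Require Import all_boot all_order all_algebra.

Import GRing.Theory.
Local Open Scope ring_scope.

(** An odd element [a] satisfies [-1/2 (a x_i - x_i a) = x_i a], so the second
    claim amounts to solving [x_i a = u_i] for all [i], with [u_i = dod x_i].
    Applying [dod] to [x_i^2 = 0] and [x_i x_j = - x_j x_i] gives
    [u_i = x_i v_i] with [v_i = partial_i u_i], and shows that [v_i] and [v_j]
    have the same coefficient at each monomial involving neither [x_i] nor
    [x_j].  Hence [a] must have at [x^S] the coefficient of [v_i] for any [i]
    outside [S]; the explicit formula picks the least such [i]. *)

Section Derivations.
Variables (K : comPzRingType) (n : nat).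
Local Notation L := (grassmann K n).
Implicit Types (f g u a b : L) (S : {set 'I_n}) (i j : 'I_n).

Lemma is_derivation1 (d : L -> L) : is_derivation d -> d 1 = 0.
Proof.
move=> /(_ 1 1); rewrite !mulr1 mul1r => e; apply: (addrI (d 1)).
by rewrite addr0 -e.
Qed.

(** Monomials are products of generators, so the Leibniz rule determines the rest; each claim is
    thereby checked at the [x_i] only. *)
Lemma derivation_ext (d e : L -> L) : linear d -> linear e ->
    is_derivation d -> is_derivation e ->
  (forall i, d (gen K i) = e (gen K i)) -> d =1 e.
Proof.
move=> dL eL dM eM de f.
pose D : {linear L -> L} := HB.pack d (GRing.isLinear.Build K L L _ d dL).
pose E : {linear L -> L} := HB.pack e (GRing.isLinear.Build K L L _ e eL).
rewrite -[d]/(D : L -> L) -[e]/(E : L -> L) (gmonomial_span f) !linear_sum.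
apply: eq_bigr => A _; rewrite !linearZ; congr (_ *: _); rewrite gmonomial_prod /=.
elim: (enum A) => [|i s IHs]; first by rewrite big_nil !is_derivation1.
by rewrite big_cons dM eM IHs de.
Qed.

(** * The sign involution and commutation with odd elements *)

Lemma gsignK : involutive (@gsign K n).
Proof. by move=> f; apply/ffunP => S; rewrite !ffunE signMK. Qed.

Lemma gsign_geven f : f \in geven -> gsign f = f.
Proof.
move/gevenP=> fe; apply/ffunP => S; rewrite ffunE -signr_odd.
by case: (boolP (odd _)) => [/fe->|_]; rewrite ?mulr0 ?mul1r.
Qed.

Lemma gsign_godd f : f \in godd -> gsign f = - f.
Proof.
move/goddP=> fo; apply/ffunP => S; rewrite !ffunE -signr_odd.
by case: (boolP (odd _)) => [_|/fo->]; rewrite ?mulN1r ?mulr0 ?oppr0.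
Qed.

(** By linearity [u] may be taken to be a monomial of odd degree: [f] picks up one [gsign] at each
    generator it passes, and an odd number of them amounts to a single one. *)
Lemma godd_comm f u : u \in godd -> f * u = u * gsign f.
Proof.
move=> /goddP uo; rewrite (gmonomial_span u) mulr_sumr mulr_suml.
apply: eq_bigr => A _; rewrite -gscaleAr -gscaleAl.
case: (boolP (odd #|A|)) => [oA|/uo->]; last by rewrite !scale0r.
congr (_ *: _).
have -> : gsign f = iter #|A| (@gsign K n) f.
  rewrite -(odd_double_half #|A|) oA add1n iterS -muln2 iterM.
  by rewrite [iter #|A|./2 _ _]iter_fix //= gsignK.
rewrite gmonomial_prod cardE.
elim: (enum A) f => [|i s IHs] g; first by rewrite big_nil mulr1 mul1r.
by rewrite big_cons mulrA mul_gen -mulrA IHs -iterSr mulrA.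
Qed.

(** * The derivations on the right-hand sides of the two claims *)

Lemma sum_partial_linear (u : 'I_n -> L) :
  linear (fun f => \sum_i u i * partial i f).
Proof.
move=> c f g; rewrite scaler_sumr -big_split; apply: eq_bigr => i _.
by rewrite linearP mulrDr gscaleAr.
Qed.

(** The skew Leibniz rule yields [u i * gsign f], which is [f * u i] because [u i] is odd. *)
Lemma sum_partial_derivation (u : 'I_n -> L) : (forall i, u i \in godd) ->
  is_derivation (fun f => \sum_i u i * partial i f).
Proof.
move=> uo f g; rewrite mulr_suml mulr_sumr -big_split; apply: eq_bigr => i _.
by rewrite partial_mul mulrDr !mulrA -godd_comm.
Qed.

Lemma sum_partial_gen (u : 'I_n -> L) j :
  \sum_i u i * partial i (gen K j) = u j.
Proof.
rewrite (bigD1 j) //= partial_gen eqxx mulr1 big1 ?addr0 // => i /negPf nij.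
by rewrite partial_gen nij mulr0.
Qed.

Lemma scaled_ad_linear (c : K) a : linear (fun f => c *: ad a f).
Proof.
move=> d f g; rewrite /ad mulrDr mulrDl -gscaleAr -gscaleAl opprD addrACA.
by rewrite -scalerBr scalerDr !scalerA mulrC.
Qed.

Lemma scaled_ad_derivation (c : K) a : is_derivation (fun f => c *: ad a f).
Proof.
move=> f g; rewrite -gscaleAl -gscaleAr -scalerDr /ad mulrBl mulrBr !mulrA.
by rewrite subrKA.
Qed.

Lemma half_ad_gen (half : K) a i : half *+ 2 = 1 -> a \in godd ->
  - half *: ad a (gen K i) = gen K i * a.
Proof.
move=> half2 ao; rewrite /ad mul_gen gsign_godd // mulrN -opprD scaleNr scalerN.
by rewrite opprK scalerDr -scalerDl -mulr2n half2 scale1r.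
Qed.

(** * Multiplication by generators in terms of coefficients *)

Lemma gen_mul_eqP i f g :
  reflect (forall S, i \notin S -> f S = g S) (gen K i * f == gen K i * g).
Proof.
apply: (iffP eqP) => [/ffunP fg S niS | fg]; last first.
  by apply/ffunP => S; rewrite !gen_mulE fg ?setD11.
have := fg (i |: S); rewrite !gen_mulE setU11 setU1K // => // e.
by rewrite -[LHS](signMK (inversions [set i] S)) e signMK.
Qed.

Lemma gen_mul_partialE i f S :
  (gen K i * partial i f) S = if i \in S then f S else 0.
Proof.
rewrite gen_mulE; case: ifP => // iS.
by rewrite ffunE setD11 setD1K // signMK.
Qed.

(** [partial i] strips the head generator, the tail acts on what is left, and [x_i] is put back with
    the same sign: a projection onto the monomials divisible by all generators listed in [s]. *)
Lemma prod_gen_partialsE (s : seq 'I_n) f S : uniq s ->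
  ((\prod_(j <- s) gen K j) * partials s f) S =
  if all (mem S) s then f S else 0.
Proof.
elim: s f S => [|i s IHs] f S /=; first by rewrite big_nil mul1r.
case/andP=> nis us; rewrite big_cons -mulrA gen_mulE.
case: ifP => //= iS; rewrite IHs //.
have -> : all (mem (S :\ i)) s = all (mem S) s.
  apply: eq_in_all => j js; rewrite /= !inE; case: eqP => // eji.
  by rewrite -eji js in nis.
by case: ifP; rewrite ?mulr0 // ffunE setD11 setD1K // signMK.
Qed.

Lemma partial_godd i f : f \in geven -> partial i f \in godd.
Proof.
move=> /gevenP fe; apply/goddP => S eS; rewrite ffunE; case: ifPn => // niS.
by rewrite fe ?mulr0 // cardsU1 niS.
Qed.

Lemma addrr_eq0_half (half : K) f : half *+ 2 = 1 -> f + f = 0 -> f = 0.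
Proof.
by move=> half2 ff; rewrite -[f]scale1r -half2 mulr2n scalerDl -scalerDr ff scaler0.
Qed.

(** * Derivations with even values at the generators *)

Section OddDerivation.
Variables (half : K) (half2 : half *+ 2 = 1).
Variables (d : L -> L) (dL : linear d) (dM : is_derivation d).
Hypothesis d_even : forall i, d (gen K i) \in geven.
Local Notation v i := (partial i (d (gen K i))).

Let d0 : d 0 = 0.
Proof. by have := dL (-1) 0 0; rewrite scaler0 addr0 scaleN1r addNr. Qed.

Let dN f : d (- f) = - d f.
Proof. by have := dL (-1) f 0; rewrite d0 !addr0 !scaleN1r. Qed.

Let d_comm i j : d (gen K i) * gen K j = gen K j * d (gen K i).
Proof. by rewrite mul_gen gsign_geven. Qed.

Lemma odd_derivation_gen i : d (gen K i) = gen K i * v i.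
Proof.
have : gen K i * d (gen K i) = 0.
  by apply: addrr_eq0_half half2 _; rewrite -{1}d_comm -dM gen_sq.
(* Hence [d x_i] lives on monomials containing [x_i], where [x_i partial_i] is the identity. *)
rewrite -(mulr0 (gen K i)) => /eqP/gen_mul_eqP vi.
apply/ffunP => S; rewrite gen_mul_partialE; case: ifPn => // /vi ->.
by rewrite ffunE.
Qed.

Lemma odd_derivation_coef i j S : i \notin S -> j \notin S -> v i S = v j S.
Proof.
have [-> //|nij] := eqVneq i j; move=> niS njS.
(* Differentiating the anticommutation relation and moving the even values to the right shows that
   twice [x_i d(x_j) + x_j d(x_i)] is zero. *)
have anti : gen K i * d (gen K j) = - (gen K j * d (gen K i)).
  apply/eqP; rewrite -subr_eq0 opprK; apply/eqP; apply: addrr_eq0_half half2 _.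
  have := congr1 d (gen_anticomm K nij); rewrite dN !dM !d_comm => /eqP.
  by rewrite -subr_eq0 opprK [X in X + _]addrC => /eqP.
have : gen K i * (gen K j * v i) = gen K i * (gen K j * v j).
  rewrite -(odd_derivation_gen j) anti {2}(odd_derivation_gen i) !mulrA.
  by rewrite (gen_anticomm K nij) mulNr.
(* Since [S] avoids both indices, [x_i] and then [x_j] can be cancelled. *)
move=> /eqP/gen_mul_eqP/(_ (j |: S)); rewrite !inE negb_or nij niS => /(_ isT).
rewrite !gen_mulE setU11 setU1K // => e.
by rewrite -[LHS](signMK (inversions [set j] S)) e signMK.
Qed.

(* Only the summand of the least index outside S contributes at S. *)
Lemma inner_coef (n_gt0 : (0 < n)%N) S : let i1 := Ordinal n_gt0 in
  let a := \sum_(i < n | (0 < i)%N)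
              (\prod_(j <- below i) gen K j) * partials (below i) (v i) + v i1 in
  (S = [set: 'I_n] -> a S = 0) /\ (forall i, i \notin S -> a S = v i S).
Proof.
move=> i1 a.
have aE : a S = \sum_i if all (mem S) (below i) then v i S else 0.
  rewrite /a ffunE sum_ffunE [RHS](bigD1 i1) //= [RHS]addrC.
  (* The separate last term of [a] is the summand of index zero, whose product is empty. *)
  have -> : below i1 = [::] :> seq 'I_n.
    by rewrite /below -(filter_pred0 (enum 'I_n)); apply: eq_filter.
  congr (_ + _); apply: eq_big => [i|i _]; first by rewrite -val_eqE lt0n.
  by rewrite prod_gen_partialsE // filter_uniq ?enum_uniq.
split=> [ST|i niS].
  by rewrite aE big1 // => i _; rewrite partial_indep ?if_same // ST inE.
have [m nmS m_min] := @arg_minnP _ i (fun k => k \notin S) (@nat_of_ord n) niS.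
rewrite aE (bigD1 m) //= big1 => [|k nkm]; last first.
  case: (boolP (k \in S)) => [kS|nkS]; first by rewrite partial_indep ?if_same.
  (* Here [m < k], so [m] belongs to [below k] but not to [S]. *)
  case: allP => // belowS; case/negP: nmS; apply: belowS.
  rewrite mem_filter mem_enum andbT ltn_neqAle m_min // andbT eq_sym.
  by rewrite (inj_eq val_inj).
rewrite addr0 ifT; first exact: odd_derivation_coef.
apply/allP => j; rewrite mem_filter => /andP[ltjm _].
by apply: contraLR ltjm => /m_min; rewrite -leqNgt.
Qed.

End OddDerivation.

End Derivations.


Theorem corollary2p5 (K : comPzRingType) (half : K) (half2 : half *+ 2 = 1)
    (n : nat) (n_gt0 : (0 < n)%N)
    (delta : {linear grassmann K n -> grassmann K n})
    (delta_der : is_derivation delta)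
    (uev uod : 'I_n -> grassmann K n)
    (uev_even : forall i : 'I_n, uev i \in geven)
    (uod_odd : forall i : 'I_n, uod i \in godd)
    (delta_gen : forall i : 'I_n, delta (gen K i) = uev i + uod i)
    (dev dod : {linear grassmann K n -> grassmann K n})
    (dev_der : is_derivation dev) (dev_even : even_map dev)
    (dod_der : is_derivation dod) (dod_odd : odd_map dod)
    (delta_split : forall f : grassmann K n, delta f = dev f + dod f) :
  (forall f : grassmann K n, dev f = \sum_(i < n) uod i * partial i f) /\
  (let i1 := Ordinal n_gt0 in
   let a := \sum_(i < n | (0 < i)%N)
              (\prod_(j <- below i) gen K j)
                * partials (below i) (partial i (uev i))
            + partial i1 (uev i1) in
   [/\ a \in godd',
       forall f : grassmann K n, dod f = - half *: ad a f
     & forall b : grassmann K n, b \in godd' ->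
         (forall f : grassmann K n, dod f = - half *: ad b f) -> b = a]).
Proof.
have gens i : dev (gen K i) = uod i /\ dod (gen K i) = uev i.
  have go : gen K i \in godd.
    by apply/goddP => S; rewrite ffunE; case: eqP => // ->; rewrite cards1.
  (* [dod x_i] is even and [dev x_i] is odd, so uniqueness of parity components identifies them. *)
  have := delta_gen i; rewrite delta_split addrC => /parity_split_uniq.
  by case=> //; [apply: dod_odd.2 | apply: dev_even.2].
split=> [f|i1 a].
  move: f; apply: derivation_ext => //.
  - exact: linearP.
  - exact: sum_partial_linear.
  - exact: sum_partial_derivation.
  - by move=> i; rewrite sum_partial_gen; case: (gens i).
have gdod i : dod (gen K i) = uev i by case: (gens i).
have dodL : linear dod by exact: linearP.
have dod_even i : dod (gen K i) \in geven by rewrite gdod.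
have aE S : (S = [set: 'I_n] -> a S = 0) /\
    (forall i, i \notin S -> a S = partial i (uev i) S).
  have := inner_coef _ _ half half2 dod dodL dod_der dod_even n_gt0 S.
  rewrite /= gdod; under eq_bigr do rewrite gdod.
  by case=> aT ai; split=> // i /ai; rewrite gdod.
have ao : a \in godd.
  apply/goddP => S eS; have [/(aE S).1 //|] := eqVneq S setT.
  (* Below the top monomial, the coefficient is one of [partial i] of an even element, which is
     odd. *)
  rewrite -subTset => /subsetPn[i _ /(aE S).2->].
  by have /goddP-> := partial_godd _ _ i _ (uev_even i).
have a_gen i : gen K i * a = uev i.
  rewrite -gdod (odd_derivation_gen _ _ half) // gdod.
  by apply/eqP/gen_mul_eqP => S; apply: (aE S).2.
split.
- by rewrite inE ao (aE _).1 // eqxx implybT.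
- apply: derivation_ext => // [||i].
  + exact: scaled_ad_linear.
  + exact: scaled_ad_derivation.
  + by rewrite gdod half_ad_gen.
- move=> b; rewrite inE => /andP[bo bT] db; apply/ffunP => S.
  (* No product [x_i b] sees the top coefficient: for [b] it vanishes by definition of [godd'] when
     [n] is odd and by parity when [n] is even. *)
  have [->|] := eqVneq S setT.
    rewrite (aE _).1 //; case: (boolP (odd n)) bT => [_ /eqP //|en _].
    by have /goddP-> := bo; rewrite // cardsT card_ord.
  rewrite -subTset => /subsetPn[i _ niS].
  have /eqP/gen_mul_eqP-> // : gen K i * b = gen K i * a.
  by rewrite a_gen -gdod db half_ad_gen.
Qed.
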